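(* Let $k,m>0$ and let $q_0\neq0$ satisfy $1+4k>4q_0$. Consider the Sturm-Liouville problem in Liouville normal form $$\text{(N)}\qquad -\frac{d^2v}{dt^2}+\frac{k}{(t+m)^2}v=\lambda v,\quad 0<t<\pi,\qquad v(0)=0=v(\pi),$$ with constant potential function $q=q_0$ and density function $r=\tau^2$, where $\tau=t+m$. Let $\rho$ be either of the two numbers $$\rho=\frac{1\pm\sqrt{1+4(k-q_0)}}{2}.$$ Then for every $x_0\in\mathbb R$, (N) has the canonical form $$-\frac{d}{dx}\left[(2\rho-1)^2(x+x_0)^2\frac{du}{dx}\right]+q_0\,u=\lambda\big[(2\rho-1)(x+x_0)\big]^{2/(2\rho-1)}u,\qquad a<x<b,$$ with Dirichlet boundary conditions $u(a)=0=u(b)$, where $$a=-x_0+\frac{1}{2\rho-1}m^{2\rho-1},\qquad b=-x_0+\frac1{2\rho-1}(\pi+m)^{2\rho-1},$$ $$\delta_0=m^{2\rho},\qquad \gamma_0=(\pi+m)^{2\rho}.$$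
   Context: A canonical form is a problem $-(p\,u')'+q\,u=\lambda r\,u$ on $a<x<b$ with boundary conditions $\delta_0u(a)-\delta_1p(a)u'(a)=0$, $\gamma_0u(b)-\gamma_1p(b)u'(b)=0$; here $\delta_1=\gamma_1=0$. We say that (N) has this canonical form if the two are related by Liouville's transformation: there is an increasing bijection $t\mapsto x(t)$ from $[0,\pi]$ onto $[a,b]$ with $dx/dt=\sqrt{p/r}$, and with $w=(pr)^{-1/4}$ one has $$\frac{k}{(t+m)^2}=\frac qr+w\frac{d^2}{dt^2}\left(\frac1w\right),$$ so that $u=wv$ turns (N), for every $\lambda$, into the canonical problem. The boundary coefficients are normalized by $\delta_0=1/w^2$ at $x=a$ and $\gamma_0=1/w^2$ at $x=b$. *)

(* Defs.v *)
From Stdlib Require Import Reals.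
From Coquelicot Require Import Coquelicot.
Open Scope R_scope.

Definition closed_itv (a b x : R) : Prop := a <= x <= b.

(* The problem -(p u')' + q u = lambda r u on a < x < b, with
   d0 u(a) - d1 p(a) u'(a) = 0 and g0 u(b) - g1 p(b) u'(b) = 0. *)
Record SL_problem : Type := {
  sl_p : R -> R;
  sl_q : R -> R;
  sl_r : R -> R;
  sl_a : R;
  sl_b : R;
  sl_d0 : R;
  sl_d1 : R;
  sl_g0 : R;
  sl_g1 : R
}.

(* Only the values of u on [a, b] matter.  Pu is p u' on ]a, b[, extended by
   continuity to the end points, where Derive, being two-sided, would also see
   values of u outside [a, b]. *)
Definition SL_solution (S : SL_problem) (lambda : R) (u : R -> R) : Prop :=
  exists Pu : R -> R,
    continuous_on (closed_itv (sl_a S) (sl_b S)) u /\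
    continuous_on (closed_itv (sl_a S) (sl_b S)) Pu /\
    (forall x : R, sl_a S < x < sl_b S ->
       ex_derive u x /\
       Pu x = sl_p S x * Derive u x /\
       ex_derive Pu x /\
       - Derive Pu x + sl_q S x * u x = lambda * sl_r S x * u x) /\
    sl_d0 S * u (sl_a S) - sl_d1 S * Pu (sl_a S) = 0 /\
    sl_g0 S * u (sl_b S) - sl_g1 S * Pu (sl_b S) = 0.

Definition liouville_normal_form (Q : R -> R) : SL_problem := {|
  sl_p := fun _ => 1;
  sl_q := Q;
  sl_r := fun _ => 1;
  sl_a := 0;
  sl_b := PI;
  sl_d0 := 1;
  sl_d1 := 0;
  sl_g0 := 1;
  sl_g1 := 0
|}.

Definition liouville_w (S : SL_problem) (x : R) : R :=
  Rpower (sl_p S x * sl_r S x) (-1 / 4).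

Definition increasing_bijection (c d a b : R) (X : R -> R) : Prop :=
  (forall t : R, c <= t <= d -> a <= X t <= b) /\
  (forall s t : R, c <= s -> s < t -> t <= d -> X s < X t) /\
  (forall x : R, a <= x <= b -> exists t : R, c <= t <= d /\ X t = x).

(* Positivity of p and r gives sqrt (p / r) and Rpower (p r) (-1/4) their usual
   meaning.  Since X is onto [a, b], the relation u (X t) = w (X t) * v t
   determines u on [a, b] from v on [0, PI] and conversely. *)
Definition liouville_transformation
    (Q : R -> R) (S : SL_problem) (X : R -> R) : Prop :=
  sl_a S < sl_b S /\
  (forall x : R, sl_a S <= x <= sl_b S -> 0 < sl_p S x /\ 0 < sl_r S x) /\
  increasing_bijection 0 PI (sl_a S) (sl_b S) X /\
  (forall t : R, 0 < t < PI ->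
     is_derive X t (sqrt (sl_p S (X t) / sl_r S (X t)))) /\
  (forall t : R, 0 < t < PI ->
     ex_derive (fun s : R => / liouville_w S (X s)) t /\
     ex_derive_n (fun s : R => / liouville_w S (X s)) 2 t /\
     Q t = sl_q S (X t) / sl_r S (X t)
           + liouville_w S (X t)
             * Derive_n (fun s : R => / liouville_w S (X s)) 2 t) /\
  (forall (lambda : R) (u v : R -> R),
     (forall t : R, 0 <= t <= PI -> u (X t) = liouville_w S (X t) * v t) ->
     (SL_solution (liouville_normal_form Q) lambda v <->
      SL_solution S lambda u)) /\
  sl_d0 S = 1 / (liouville_w S (sl_a S)) ^ 2 /\ sl_d1 S = 0 /\
  sl_g0 S = 1 / (liouville_w S (sl_b S)) ^ 2 /\ sl_g1 S = 0.

(* For a prescribed potential and density along the transformation, as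
   functions of t: q (X t) = qt t and r (X t) = rt t. *)
Definition has_canonical_form
    (Q : R -> R) (qt rt : R -> R) (S : SL_problem) : Prop :=
  exists X : R -> R,
    liouville_transformation Q S X /\
    (forall t : R, 0 <= t <= PI ->
       sl_q S (X t) = qt t /\ sl_r S (X t) = rt t).

(* Main.v *)
Require Import Defs.
From Stdlib Require Import Reals Lra.
From Coquelicot Require Import Coquelicot.
Open Scope R_scope.

(* With tau = t + m and c = 2 rho - 1, put x = -x0 + tau^c / c.  Then
   dx/dt = tau^(c - 1) > 0 whatever the sign of c, c (x + x0) = tau^c, p = tau^(2c)
   and r = tau^2, so 1/w = (p r)^(1/4) = tau^rho and
   w (1/w)'' = rho (rho - 1) / tau^2 = (k - q0) / tau^2. *)

(** * Continuity on a set and derivatives on an interval *)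

(** Serves to carry continuity, one-sided at the end points, from one closed interval to the other
    through [X] and [T]. *)
Lemma continuous_on_comp {T U V : UniformSpace} (D : T -> Prop) (E : U -> Prop)
    (f : T -> U) (g : U -> V) :
  (forall x, D x -> E (f x)) ->
  continuous_on D f -> continuous_on E g -> continuous_on D (fun x => g (f x)).
Proof.
  intros HDE Hf Hg x Dx P HP.
  specialize (Hg (f x) (HDE x Dx) P HP).
  specialize (Hf x Dx _ Hg).
  unfold filtermap, within in *.
  revert Hf; apply filter_imp; intros y Hy Dy; exact (Hy Dy (HDE y Dy)).
Qed.

Lemma continuous_on_plus (D : R -> Prop) (f g : R -> R) :
  continuous_on D f -> continuous_on D g -> continuous_on D (fun x => f x + g x).
Proof.
  intros Hf Hg x Dx.
  eapply filterlim_comp_2; [exact (Hf x Dx) | exact (Hg x Dx) |].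
  exact (filterlim_plus (f x) (g x)).
Qed.

Lemma continuous_on_mult (D : R -> Prop) (f g : R -> R) :
  continuous_on D f -> continuous_on D g -> continuous_on D (fun x => f x * g x).
Proof.
  intros Hf Hg x Dx.
  eapply filterlim_comp_2; [exact (Hf x Dx) | exact (Hg x Dx) |].
  exact (filterlim_mult (f x) (g x)).
Qed.

Lemma continuous_on_opp (D : R -> Prop) (f : R -> R) :
  continuous_on D f -> continuous_on D (fun x => - f x).
Proof.
  intros Hf x Dx.
  eapply filterlim_comp; [exact (Hf x Dx) | exact (filterlim_opp (f x))].
Qed.

Lemma continuous_on_inv (D : R -> Prop) (f : R -> R) :
  (forall x, D x -> f x <> 0) ->
  continuous_on D f -> continuous_on D (fun x => / f x).
Proof.
  intros Hn Hf x Dx.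
  eapply filterlim_comp; [exact (Hf x Dx) |].
  apply (filterlim_Rbar_inv (f x)).
  intros H; injection H; exact (Hn x Dx).
Qed.

Lemma is_derive_continuous_on (D : R -> Prop) (f df : R -> R) :
  (forall x, D x -> is_derive f x (df x)) -> continuous_on D f.
Proof.
  intros H; apply continuous_on_forall; intros x Dx.
  apply (ex_derive_continuous f); exists (df x); exact (H x Dx).
Qed.

(** A derivative at an interior point sees only nearby values. This allows differentiating the
    relation between [u] and [v], which says nothing outside the closed intervals. *)
Lemma is_derive_ext_Ioo (a b x l : R) (f g : R -> R) :
  a < x < b -> (forall y, a <= y <= b -> f y = g y) ->
  is_derive f x l -> is_derive g x l.
Proof.
  intros [ax xb] Hfg; apply is_derive_ext_loc.
  apply (locally_interval _ x a b ax xb).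
  intros y ay yb; apply Hfg; simpl in ay, yb; lra.
Qed.

(** Mean value theorem. Both [X] and its inverse [T] get their monotonicity from it, with no case
    distinction on the sign of the exponent. *)
Lemma increasing_of_is_derive_pos (a b : R) (f df : R -> R) :
  (forall x, a <= x <= b -> is_derive f x (df x)) ->
  (forall x, a <= x <= b -> 0 < df x) ->
  forall x y, a <= x -> x < y -> y <= b -> f x < f y.
Proof.
  intros Hd Hp x y ax xy yb.
  destruct (MVT_gen f x y df) as [c [Hc E]].
  - intros z Hz; rewrite Rmin_left, Rmax_right in Hz by lra; apply Hd; lra.
  - intros z Hz; rewrite Rmin_left, Rmax_right in Hz by lra.
    apply continuity_pt_filterlim, (ex_derive_continuous f).
    exists (df z); apply Hd; lra.
  - rewrite Rmin_left, Rmax_right in Hc by lra.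
    assert (0 < df c * (y - x)) by (apply Rmult_lt_0_compat; [apply Hp|]; lra).
    lra.
Qed.

(** * Equivalence of the two problems under Liouville's transformation *)

(* [z] stands for 1/w along the transformation and [g] for dx/dt, so that
   p = z^2 g and r = z^2 / g; then p u' = z v' - z' v at corresponding points. *)
Lemma liouville_solution_equiv (Q : R -> R) (S : SL_problem)
    (X T g z z1 z2 u v : R -> R) (lambda : R) :
  (forall t, 0 <= t <= PI ->
     is_derive X t (g t) /\ is_derive z t (z1 t) /\ is_derive z1 t (z2 t)) ->
  (forall t, 0 <= t <= PI -> 0 < g t /\ 0 < z t) ->
  (forall t, 0 <= t <= PI ->
     sl_p S (X t) = z t ^ 2 * g t /\ sl_r S (X t) = z t ^ 2 / g t /\
     Q t = sl_q S (X t) / sl_r S (X t) + z2 t / z t) ->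
  (forall t, 0 <= t <= PI -> sl_a S <= X t <= sl_b S /\ T (X t) = t) ->
  (forall x, sl_a S <= x <= sl_b S ->
     0 <= T x <= PI /\ X (T x) = x /\ is_derive T x (/ g (T x))) ->
  X 0 = sl_a S -> X PI = sl_b S ->
  sl_d0 S <> 0 -> sl_d1 S = 0 -> sl_g0 S <> 0 -> sl_g1 S = 0 ->
  (forall t, 0 <= t <= PI -> u (X t) = v t / z t) ->
  SL_solution (liouville_normal_form Q) lambda v <-> SL_solution S lambda u.
Proof.
  intros HD Hpos Hcoef HX HT X0 Xpi Hd0 Hd1 Hg0 Hg1 Huv.
  pose proof PI_RGT_0 as Hpi.
  assert (cX : continuous_on (closed_itv 0 PI) X).
  { apply (is_derive_continuous_on _ _ g); intros t Ht; apply (HD t Ht). }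
  assert (cz : continuous_on (closed_itv 0 PI) z).
  { apply (is_derive_continuous_on _ _ z1); intros t Ht; apply (HD t Ht). }
  assert (cz1 : continuous_on (closed_itv 0 PI) z1).
  { apply (is_derive_continuous_on _ _ z2); intros t Ht; apply (HD t Ht). }
  assert (cT : continuous_on (closed_itv (sl_a S) (sl_b S)) T).
  { apply (is_derive_continuous_on _ _ (fun x => / g (T x))).
    intros x Hx; apply (HT x Hx). }
  assert (czi : continuous_on (closed_itv 0 PI) (fun t => / z t)).
  { apply continuous_on_inv; [|exact cz].
    intros t Ht; pose proof (Hpos t Ht); lra. }
  (* Interior points go to interior points: if [X t] were an end point, applying [T] would give
     [t = 0] or [t = PI]. *)
  assert (iX : forall t, 0 < t < PI -> sl_a S < X t < sl_b S).
  { intros t Ht; destruct (HX t) as [[H1 H2] H3]; [lra|].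
    destruct (HX 0) as [_ H4]; [lra|]; destruct (HX PI) as [_ H5]; [lra|].
    split.
    - destruct H1 as [|E]; [assumption|]; rewrite <- E, <- X0 in H3; lra.
    - destruct H2 as [|E]; [assumption|]; rewrite E, <- Xpi in H3; lra. }
  assert (iT : forall x, sl_a S < x < sl_b S -> 0 < T x < PI).
  { intros x Hx; destruct (HT x) as [[H1 H2] [H3 _]]; [lra|].
    split.
    - destruct H1 as [|E]; [assumption|]; rewrite <- E in H3; lra.
    - destruct H2 as [|E]; [assumption|]; rewrite E in H3; lra. }
  (* The relation between [u] and [v] is put in the two forms to be differentiated: [u] as a
     function of [x], then [v] as a function of [t]. *)
  assert (Huv' : forall x, sl_a S <= x <= sl_b S -> v (T x) / z (T x) = u x).
  { intros x Hx; destruct (HT x Hx) as [H1 [H2 _]].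
    rewrite <- (Huv _ H1), H2; reflexivity. }
  assert (Hvu : forall t, 0 <= t <= PI -> z t * u (X t) = v t).
  { intros t Ht; rewrite (Huv t Ht); pose proof (Hpos t Ht); field; lra. }
  split.
  - intros [Pv [cv [cPv [Hv [Hv0 Hvpi]]]]]; simpl in *.
    (* This is [z v' - z' v] at [t = T x]. It equals [p u'] because [u = v / z], [dt/dx = 1 / g] and
       [p = z^2 g]. *)
    exists (fun x => z (T x) * Pv (T x) + - (z1 (T x) * v (T x))).
    split; [|split; [|split; [|split]]].
    + apply (continuous_on_ext _ _ _ Huv').
      apply (continuous_on_comp _ (closed_itv 0 PI) T (fun t => v t / z t));
        [intros x Hx; apply (HT x Hx) | exact cT |].
      apply continuous_on_mult; assumption.
    + apply (continuous_on_comp _ (closed_itv 0 PI) T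
               (fun t => z t * Pv t + - (z1 t * v t)));
        [intros x Hx; apply (HT x Hx) | exact cT |].
      apply continuous_on_plus; [|apply continuous_on_opp];
        apply continuous_on_mult; assumption.
    + intros x Hx.
      pose proof (iT x Hx) as Ht.
      destruct (HT x) as [_ [XT dT]]; [lra|].
      destruct (Hv (T x) Ht) as [dv [EPv [dPv Eq]]].
      destruct (HD (T x)) as [_ [dz dz1]]; [lra|].
      destruct (Hpos (T x)) as [gpos zpos]; [lra|].
      destruct (Hcoef (T x)) as [Ep [Er EQ]]; [lra|].
      rewrite XT in Ep, Er, EQ.
      apply Derive_correct in dv; apply Derive_correct in dPv.
      set (t := T x) in *.
      assert (du : is_derive u x
                (/ g t * ((Derive v t * z t - v t * z1 t) / z t ^ 2))).
      { apply (is_derive_ext_Ioo _ _ _ _ _ _ Hx Huv').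
        apply (is_derive_comp (fun t => v t / z t) T x _ _); [|exact dT].
        apply is_derive_div; [exact dv | exact dz | unfold t in *; lra]. }
      assert (dPu : is_derive (fun x : R => z (T x) * Pv (T x) + - (z1 (T x) * v (T x))) x
         (/ g t * (plus (z1 t * Pv t + z t * Derive Pv t)
                        (opp (z2 t * v t + z1 t * Derive v t))))).
      { apply (is_derive_comp (fun t => z t * Pv t + - (z1 t * v t)) T x _ _);
          [|exact dT].
        apply (is_derive_plus (fun t => z t * Pv t) (fun t => - (z1 t * v t))).
        - apply Derive.is_derive_mult; [exact dz | exact dPv].
        - apply (is_derive_opp (fun t => z1 t * v t)).
          apply Derive.is_derive_mult; [exact dz1 | exact dv]. }
      split; [eexists; exact du|].
      split; [|split; [eexists; exact dPu|]].
      * rewrite (is_derive_unique _ _ _ du), Ep, EPv; field; lra.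
      * rewrite (is_derive_unique _ _ _ dPu).
        (* The normal form is solved for [v'']. The products [z' v'] cancel, leaving
           [(z v'' - z'' v) / g]; the term [z2 / z] of [Q] then removes [z'' v], and [r = z^2 / g]
           gives [(q - lambda r) u]. *)
        replace (Derive Pv t) with (Q t * v t - lambda * 1 * v t) by lra.
        rewrite EQ, Er, EPv, <- (Huv' x) by lra.
        fold t; unfold plus, opp; simpl; field; lra.
    + rewrite Hd1, <- X0, Huv by lra.
      replace (v 0) with 0 by lra; unfold Rdiv; ring.
    + rewrite Hg1, <- Xpi, Huv by lra.
      replace (v PI) with 0 by lra; unfold Rdiv; ring.
  - intros [Pu [cu [cPu [Hu [Hu0 Hupi]]]]].
    (* The identity [p u' = z v' - z' v] solved for [v'], with [v = z u]. *)
    exists (fun t => / z t * Pu (X t) + z1 t * u (X t)).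
    assert (cuX : continuous_on (closed_itv 0 PI) (fun t => u (X t))).
    { apply (continuous_on_comp _ (closed_itv (sl_a S) (sl_b S)));
        [intros t Ht; apply (HX t Ht) | |]; assumption. }
    assert (cPuX : continuous_on (closed_itv 0 PI) (fun t => Pu (X t))).
    { apply (continuous_on_comp _ (closed_itv (sl_a S) (sl_b S)));
        [intros t Ht; apply (HX t Ht) | |]; assumption. }
    simpl; split; [|split; [|split; [|split]]].
    + apply (continuous_on_ext _ _ _ Hvu).
      apply continuous_on_mult; assumption.
    + apply continuous_on_plus; apply continuous_on_mult; assumption.
    + intros t Ht.
      destruct (Hu (X t) (iX t Ht)) as [du [EPu [dPu Eq]]].
      destruct (HD t) as [dX [dz dz1]]; [lra|].
      destruct (Hpos t) as [gpos zpos]; [lra|].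
      destruct (Hcoef t) as [Ep [Er EQ]]; [lra|].
      apply Derive_correct in du; apply Derive_correct in dPu.
      set (u' := Derive u (X t)) in *; set (Pu' := Derive Pu (X t)) in *.
      assert (duX : is_derive (fun t => u (X t)) t (g t * u'))
        by exact (is_derive_comp u X t _ _ du dX).
      assert (dPuX : is_derive (fun t => Pu (X t)) t (g t * Pu'))
        by exact (is_derive_comp Pu X t _ _ dPu dX).
      assert (dv : is_derive v t (z1 t * u (X t) + z t * (g t * u'))).
      { apply (is_derive_ext_Ioo _ _ _ _ _ _ Ht Hvu).
        exact (Derive.is_derive_mult _ _ _ _ _ dz duX). }
      assert (dzi : is_derive (fun t => / z t) t (- z1 t / z t ^ 2))
        by (apply is_derive_inv; [exact dz | lra]).
      assert (dPv : is_derive (fun t : R => / z t * Pu (X t) + z1 t * u (X t)) t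
         (plus (- z1 t / z t ^ 2 * Pu (X t) + / z t * (g t * Pu'))
               (z2 t * u (X t) + z1 t * (g t * u')))).
      { apply (is_derive_plus (fun t => / z t * Pu (X t))
                              (fun t => z1 t * u (X t)));
          [exact (Derive.is_derive_mult _ _ _ _ _ dzi dPuX)
          |exact (Derive.is_derive_mult _ _ _ _ _ dz1 duX)]. }
      split; [eexists; exact dv|].
      split; [|split; [eexists; exact dPv|]].
      * rewrite (is_derive_unique _ _ _ dv), EPu, Ep; field; lra.
      * rewrite (is_derive_unique _ _ _ dPv).
        (* Here the canonical equation is solved for [(p u')']. The two terms in [z' u'] cancel
           since [Pu = z^2 g u']. *)
        replace Pu' with (sl_q S (X t) * u (X t) - lambda * sl_r S (X t) * u (X t))
          by lra.
        rewrite EQ, Er, EPu, Ep, <- (Hvu t) by lra.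
        unfold plus; simpl; field; lra.
    (* The boundary condition reads [sl_d0 S * u (sl_a S) = 0], and the nonzero coefficient can be
       cancelled. *)
    + rewrite <- Hvu, X0 by lra; rewrite Hd1 in Hu0.
      replace (u (sl_a S)) with 0; [ring|].
      symmetry; apply (Rmult_eq_reg_l (sl_d0 S)); [lra | exact Hd0].
    + rewrite <- Hvu, Xpi by lra; rewrite Hg1 in Hupi.
      replace (u (sl_b S)) with 0; [ring|].
      symmetry; apply (Rmult_eq_reg_l (sl_g0 S)); [lra | exact Hg0].
Qed.

(** * Powers with a real exponent *)

Lemma is_derive_Rpower (a x : R) :
  0 < x -> is_derive (fun y => Rpower y a) x (a * Rpower x (a - 1)).
Proof.
  intros Hx; apply is_derive_Reals, derivable_pt_lim_power; exact Hx.
Qed.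

Lemma is_derive_Rpower_shift (a m t : R) :
  0 < t + m ->
  is_derive (fun s => Rpower (s + m) a) t (a * Rpower (t + m) (a - 1)).
Proof.
  intros Ht.
  replace (a * Rpower (t + m) (a - 1))
    with (1 * (a * Rpower (t + m) (a - 1))) by ring.
  apply (is_derive_comp (fun y => Rpower y a) (fun s => s + m)).
  - apply is_derive_Rpower; exact Ht.
  - auto_derive; [exact I | ring].
Qed.

Lemma Rpower_pos (x a : R) : 0 < Rpower x a.
Proof. apply exp_pos. Qed.

Lemma Rpower_minus_1 (x a : R) : 0 < x -> Rpower x (a - 1) = Rpower x a / x.
Proof.
  intros Hx; unfold Rminus; rewrite Rpower_plus, Rpower_Ropp, Rpower_1 by exact Hx.
  reflexivity.
Qed.

Lemma Rpower_double (x a : R) : Rpower x (2 * a) = Rpower x a ^ 2.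
Proof. replace (2 * a) with (a + a) by ring; rewrite Rpower_plus; ring. Qed.

(** * The explicit change of variable for constant potential and density [(t + m)^2] *)

Theorem theorem5 :
  forall (k m q0 rho : R),
    0 < k -> 0 < m -> q0 <> 0 -> 1 + 4 * k > 4 * q0 ->
    (rho = (1 + sqrt (1 + 4 * (k - q0))) / 2 \/
     rho = (1 - sqrt (1 + 4 * (k - q0))) / 2) ->
  forall x0 : R,
    has_canonical_form
      (fun t => k / (t + m) ^ 2)
      (fun _ => q0)
      (fun t => (t + m) ^ 2)
      {| sl_p := fun x => (2 * rho - 1) ^ 2 * (x + x0) ^ 2;
         sl_q := fun _ => q0;
         sl_r := fun x => Rpower ((2 * rho - 1) * (x + x0)) (2 / (2 * rho - 1));
         sl_a := - x0 + 1 / (2 * rho - 1) * Rpower m (2 * rho - 1);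
         sl_b := - x0 + 1 / (2 * rho - 1) * Rpower (PI + m) (2 * rho - 1);
         sl_d0 := Rpower m (2 * rho);
         sl_d1 := 0;
         sl_g0 := Rpower (PI + m) (2 * rho);
         sl_g1 := 0 |}.
Proof.
  intros k m q0 rho Hk Hm Hq0 Hkq Hrho x0.
  pose proof PI_RGT_0 as Hpi.
  (* [2 rho - 1] is plus or minus the square root, whose argument is positive by
     [1 + 4 k > 4 q0]. *)
  assert (Hc : 2 * rho - 1 <> 0).
  { assert (0 < sqrt (1 + 4 * (k - q0))) by (apply sqrt_lt_R0; lra).
    destruct Hrho; lra. }
  (* Both choices of [rho] are roots of this quadratic equation; from here on only this and [c <> 0]
     matter. *)
  assert (Hrr : rho * (rho - 1) = k - q0).
  { assert (E := sqrt_sqrt (1 + 4 * (k - q0))).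
    destruct Hrho as [-> | ->]; lra. }
  match goal with |- has_canonical_form _ _ _ ?S0 => set (S := S0) end.
  set (c := 2 * rho - 1) in *.
  set (X := fun t => - x0 + 1 / c * Rpower (t + m) c).
  (* The inverse of [X], from solving [c (x + x0) = tau^c] for [tau]. *)
  set (T := fun x => Rpower (c * (x + x0)) (/ c) - m).
  set (P := fun t => Rpower (t + m) rho).
  set (g := fun t => Rpower (t + m) (c - 1)).
  assert (cX : forall t, c * (X t + x0) = Rpower (t + m) c)
    by (intros t; unfold X; field; exact Hc).
  assert (Ppos : forall t, 0 < P t) by (intros t; apply Rpower_pos).
  (* Since [c = 2 rho - 1], every power that occurs is a rational expression in [P t = tau^rho] and
     [tau], which [field] can handle. *)
  assert (powc : forall t, 0 < t + m -> Rpower (t + m) c = P t ^ 2 / (t + m)).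
  { intros t Ht; unfold c; rewrite Rpower_minus_1, Rpower_double by exact Ht.
    reflexivity. }
  assert (Eg : forall t, 0 < t + m -> g t = P t ^ 2 / (t + m) ^ 2).
  { intros t Ht; unfold g; rewrite Rpower_minus_1, powc by exact Ht.
    field; lra. }
  assert (dX : forall t, 0 < t + m -> is_derive X t (g t)).
  { intros t Ht; unfold X.
    replace (g t) with (plus 0 (1 / c * (c * Rpower (t + m) (c - 1))))
      by (unfold plus, g; simpl; field; exact Hc).
    apply (is_derive_plus (fun _ => - x0) (fun t => 1 / c * Rpower (t + m) c)).
    - apply (is_derive_const (- x0)).
    - apply is_derive_scal, is_derive_Rpower_shift; exact Ht. }
  assert (TX : forall t, 0 < t + m -> T (X t) = t).
  { intros t Ht; unfold T; rewrite cX, Rpower_mult.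
    replace (c * / c) with 1 by (field; exact Hc).
    rewrite Rpower_1 by exact Ht; ring. }
  (* Holds for every [x], because [Rpower] is an exponential whatever its base. *)
  assert (Tm : forall x, 0 < T x + m).
  { intros x; unfold T; ring_simplify; apply Rpower_pos. }
  assert (powT : forall x, 0 < c * (x + x0) -> Rpower (T x + m) c = c * (x + x0)).
  { intros x Hx; unfold T.
    replace (Rpower (c * (x + x0)) (/ c) - m + m)
      with (Rpower (c * (x + x0)) (/ c)) by ring.
    rewrite Rpower_mult.
    replace (/ c * c) with 1 by (field; exact Hc).
    apply Rpower_1; exact Hx. }
  assert (XT : forall x, 0 < c * (x + x0) -> X (T x) = x).
  { intros x Hx; unfold X; rewrite powT by exact Hx; field; exact Hc. }
  assert (dT : forall x, 0 < c * (x + x0) -> is_derive T x (/ g (T x))).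
  { intros x Hx.
    replace (/ g (T x))
      with (plus (c * (/ c * Rpower (c * (x + x0)) (/ c - 1))) 0).
    - apply (is_derive_plus (fun x => Rpower (c * (x + x0)) (/ c)) (fun _ => - m)).
      + apply (is_derive_comp (fun y => Rpower y (/ c)) (fun x => c * (x + x0))).
        * apply is_derive_Rpower; exact Hx.
        * auto_derive; [exact I | ring].
      + apply (is_derive_const (- m)).
    (* With [y = c (x + x0) = tau^c], both sides are [tau / y], where [tau = y^(1/c)]. *)
    - unfold g; rewrite !Rpower_minus_1, powT by auto.
      replace (T x + m) with (Rpower (c * (x + x0)) (/ c)) by (unfold T; ring).
      pose proof (Rpower_pos (c * (x + x0)) (/ c)).
      unfold plus; simpl; field.
      repeat split; [lra | intros E; rewrite E in Hx; lra | exact Hc]. }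
  assert (X0 : X 0 = sl_a S) by (unfold X; simpl; rewrite Rplus_0_l; reflexivity).
  assert (Xpi : X PI = sl_b S) by reflexivity.
  assert (incX : forall s t, 0 <= s -> s < t -> t <= PI -> X s < X t).
  { apply (increasing_of_is_derive_pos _ _ X g).
    - intros t Ht; apply dX; lra.
    - intros t Ht; apply Rpower_pos. }
  assert (Xle : forall t, 0 <= t <= PI -> sl_a S <= X t <= sl_b S).
  { intros t Ht; rewrite <- X0, <- Xpi; split.
    - destruct (proj1 Ht) as [H | <-]; [|lra]; apply Rlt_le, incX; lra.
    - destruct (proj2 Ht) as [H | ->]; [|lra]; apply Rlt_le, incX; lra. }
  (* [c (x + x0)] lies between [m^c] and [(PI + m)^c], both positive; the sign of [c] decides which
     of them is the lower bound. *)
  assert (dom : forall x, sl_a S <= x <= sl_b S -> 0 < c * (x + x0)).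
  { intros x Hx; rewrite <- X0, <- Xpi in Hx.
    pose proof (cX 0) as E0; pose proof (cX PI) as E1.
    pose proof (Rpower_pos (0 + m) c); pose proof (Rpower_pos (PI + m) c).
    destruct (Rlt_or_le 0 c) as [Hc0 | Hc0].
    - assert (c * (X 0 + x0) <= c * (x + x0)) by (apply Rmult_le_compat_l; lra).
      lra.
    - assert (- c * (x + x0) <= - c * (X PI + x0))
        by (apply Rmult_le_compat_l; lra).
      lra. }
  assert (incT : forall x y, sl_a S <= x -> x < y -> y <= sl_b S -> T x < T y).
  { apply (increasing_of_is_derive_pos _ _ T (fun x => / g (T x))).
    - intros x Hx; apply dT, dom, Hx.
    - intros x Hx; apply Rinv_0_lt_compat, Rpower_pos. }
  assert (Ta : T (sl_a S) = 0) by (rewrite <- X0; apply TX; lra).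
  assert (Tb : T (sl_b S) = PI) by (rewrite <- Xpi; apply TX; lra).
  assert (Tle : forall x, sl_a S <= x <= sl_b S -> 0 <= T x <= PI).
  { intros x Hx; rewrite <- Ta, <- Tb; split.
    - destruct (proj1 Hx) as [H | <-]; [|lra]; apply Rlt_le, incT; lra.
    - destruct (proj2 Hx) as [H | ->]; [|lra]; apply Rlt_le, incT; lra. }
  assert (Ep : forall t, 0 < t + m -> sl_p S (X t) = P t ^ 2 * g t).
  { intros t Ht; change (sl_p S (X t)) with (c ^ 2 * (X t + x0) ^ 2).
    replace (c ^ 2 * (X t + x0) ^ 2) with ((c * (X t + x0)) ^ 2) by ring.
    rewrite cX, Eg, powc by exact Ht; field; lra. }
  assert (Er2 : forall t, 0 < t + m -> sl_r S (X t) = (t + m) ^ 2).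
  { intros t Ht; change (sl_r S (X t)) with (Rpower (c * (X t + x0)) (2 / c)).
    rewrite cX, Rpower_mult.
    (* The exponent is written as [INR 2] so that [Rpower_pow] turns the real power into
       [(t + m) ^ 2]. *)
    replace (c * (2 / c)) with (INR 2) by (simpl; field; exact Hc).
    apply Rpower_pow; exact Ht. }
  assert (Er : forall t, 0 < t + m -> sl_r S (X t) = P t ^ 2 / g t).
  { intros t Ht; rewrite Er2, Eg by exact Ht.
    pose proof (Ppos t); field; lra. }
  (* The factors [g] cancel in [p r = P^4], whence [w = (P^4)^(-1/4) = 1 / P]. *)
  assert (Ew : forall t, 0 < t + m -> liouville_w S (X t) = / P t).
  { intros t Ht; unfold liouville_w; rewrite Ep, Er by exact Ht.
    replace (P t ^ 2 * g t * (P t ^ 2 / g t)) with (P t ^ 4)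
      by (field; apply Rgt_not_eq, Rpower_pos).
    rewrite <- Rpower_pow by apply Ppos.
    unfold P; rewrite !Rpower_mult, <- Rpower_Ropp.
    f_equal; simpl; field. }
  set (P1 := fun t => rho * Rpower (t + m) (rho - 1)).
  set (P2 := fun t => rho * ((rho - 1) * Rpower (t + m) (rho - 1 - 1))).
  assert (dP : forall t, 0 < t + m -> is_derive P t (P1 t))
    by (intros t Ht; apply is_derive_Rpower_shift; exact Ht).
  assert (dP1 : forall t, 0 < t + m -> is_derive P1 t (P2 t))
    by (intros t Ht; apply is_derive_scal, is_derive_Rpower_shift; exact Ht).
  assert (EQ : forall t, 0 < t + m ->
            k / (t + m) ^ 2 = sl_q S (X t) / sl_r S (X t) + P2 t / P t).
  (* [P2 / P = rho (rho - 1) / tau^2] and [q / r = q0 / tau^2], with sum [k / tau^2]. *)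
  { intros t Ht; rewrite Er2 by exact Ht; unfold P2.
    rewrite !Rpower_minus_1 by exact Ht; fold (P t).
    replace k with (q0 + rho * (rho - 1)) by lra.
    pose proof (Ppos t); simpl sl_q; field; lra. }
  assert (Hsol : forall lambda u v,
    (forall t, 0 <= t <= PI -> u (X t) = liouville_w S (X t) * v t) ->
    SL_solution (liouville_normal_form (fun t => k / (t + m) ^ 2)) lambda v <->
    SL_solution S lambda u).
  { intros lambda u v Huv.
    apply (liouville_solution_equiv _ S X T g P P1 P2).
    - intros t Ht; split; [|split]; [apply dX | apply dP | apply dP1]; lra.
    - intros t Ht; split; apply Rpower_pos.
    - intros t Ht; split; [|split]; [apply Ep | apply Er | apply EQ]; lra.
    - intros t Ht; split; [apply Xle, Ht | apply TX; lra].
    - intros x Hx; pose proof (dom x Hx).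
      split; [|split]; [apply Tle | apply XT | apply dT]; assumption.
    - exact X0.
    - exact Xpi.
    - apply Rgt_not_eq, Rpower_pos.
    - reflexivity.
    - apply Rgt_not_eq, Rpower_pos.
    - reflexivity.
    - intros t Ht; rewrite Huv, Ew by lra; unfold Rdiv; ring. }
  exists X; split.
  2:{ intros t Ht; split; [reflexivity | apply Er2; lra]. }
  refine (conj _ (conj _ (conj (conj Xle (conj incX _))
            (conj _ (conj _ (conj Hsol (conj _ (conj eq_refl (conj _ eq_refl))))))))).
  - rewrite <- X0, <- Xpi; apply incX; lra.
  - intros x Hx; split; [|apply Rpower_pos].
    (* Positivity of [p] is read at [x = X (T x)], where [p = P^2 g]. *)
    rewrite <- (XT x), Ep by (apply dom, Hx || apply Tm).
    apply Rmult_lt_0_compat; [apply pow_lt, Ppos | apply Rpower_pos].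
  - intros x Hx; exists (T x); split; [apply Tle, Hx | apply XT, dom, Hx].
  - intros t Ht; rewrite Ep, Er by lra.
    assert (0 < g t) by apply Rpower_pos; pose proof (Ppos t).
    (* [p / r = g^2] with [g > 0], so the square root is [g = dx/dt]. *)
    replace (P t ^ 2 * g t / (P t ^ 2 / g t)) with (g t ^ 2) by (field; lra).
    rewrite sqrt_pow2 by lra; apply dX; lra.
  - intros t Ht.
    (* [1 / w] along [X] is known to be [P] only where [s + m > 0], so derivatives are compared on a
       neighbourhood of [t] inside the open interval. *)
    assert (L : locally t (fun s : R => P s = / liouville_w S (X s) /\ 0 < s + m)).
    { apply (locally_interval _ t 0 PI); [apply Ht | apply Ht |].
      intros s H1 H2; simpl in H1, H2; split; [|lra].
      rewrite Ew by lra; rewrite Rinv_inv; reflexivity. }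
    assert (d1 : locally t (fun s => P1 s = Derive P s)).
    { revert L; apply filter_imp; intros s [_ Hs].
      symmetry; apply is_derive_unique, dP, Hs. }
    (* [Derive_n] at order 2 differentiates the function [Derive P], which agrees with [P1] near
       [t]. *)
    assert (d2 : is_derive (Derive P) t (P2 t)).
    { apply (is_derive_ext_loc P1); [exact d1 | apply dP1; lra]. }
    assert (L' : locally t (fun s => P s = / liouville_w S (X s)))
      by (revert L; apply filter_imp; intros s [H _]; exact H).
    split; [|split].
    + apply (ex_derive_ext_loc P); [exact L'|]; exists (P1 t); apply dP; lra.
    + apply (ex_derive_n_ext_loc P); [exact L'|]; exists (P2 t); exact d2.
    + rewrite <- (Derive_n_ext_loc P (fun s : R => / liouville_w S (X s)) 2 t L').
      replace (Derive_n P 2 t) with (P2 t)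
        by (symmetry; exact (is_derive_unique _ _ _ d2)).
      rewrite (EQ t), Ew by lra; unfold Rdiv; ring.
  (* Normalization at the ends: [1 / w^2 = P^2 = tau^(2 rho)], at [tau = m] here and at
     [tau = PI + m] next. *)
  - simpl sl_d0; rewrite <- X0, Ew, Rpower_double by lra.
    unfold P; rewrite Rplus_0_l; pose proof (Rpower_pos m rho); field; lra.
  - simpl sl_g0; rewrite <- Xpi, Ew, Rpower_double by lra.
    fold (P PI); pose proof (Ppos PI); field; lra.
Qed.
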